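(* Let $\mathbb{K}$ be a field of characteristic zero and let $d,t\ge 1$ be integers. The categories $\mathbf{Sym}_0(d,t)$ and $\mathbf{NilpQuad}_{d,t}$ are equivalent.
   Context: All Lie algebras are over a field $\mathbb{K}$ of characteristic zero. For a Lie algebra $\mathfrak{n}$ put $\mathfrak{n}^1=\mathfrak{n}$, $\mathfrak{n}^i=[\mathfrak{n}^{i-1},\mathfrak{n}]$; $\mathfrak{n}$ is $t$-nilpotent if $\mathfrak{n}^{t+1}=0$ and $\mathfrak{n}^t\neq 0$. The type of a nilpotent Lie algebra $\mathfrak{n}$ is $\dim \mathfrak{n}/\mathfrak{n}^2$. $\mathfrak{n}_{d,t}=\mathfrak{FL}(d)/\mathfrak{FL}(d)^{t+1}$ is the free $t$-nilpotent Lie algebra on $d$ generators, where $\mathfrak{FL}(d)$ is the free Lie algebra on $d$ generators. A bilinear form $B$ on a Lie algebra is invariant if $B([x,y],z)=B(x,[y,z])$ for all $x,y,z$. A quadratic Lie algebra is a pair $(\mathfrak{n},B)$ with $B$ a nondegenerate symmetric invariant bilinear form on $\mathfrak{n}$. For a symmetric bilinear form, $\mathrm{Ker}(B)=\{x : B(x,y)=0\ \forall y\}$. $\mathbf{NilpQuad}_{d,t}$: objects are the $t$-nilpotent quadratic Lie algebras $(\mathfrak{n},B)$ of type $d$; morphisms $(\mathfrak{n},B)\to(\mathfrak{n}',B')$ are the Lie algebra homomorphisms $\varphi$ with $B(x,y)=B'(\varphi(x),\varphi(y))$ for all $x,y$. $\mathbf{Sym}_0(d,t)$: objects are the invariant symmetric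 bilinear forms $B$ on $\mathfrak{n}_{d,t}$ with $\mathrm{Ker}(B)\subseteq \mathfrak{n}_{d,t}^2$ and $\mathfrak{n}_{d,t}^t\nsubseteq \mathrm{Ker}(B)$. For objects $B_1,B_2$ let $MEnd_\perp(B_1,B_2)$ be the set of Lie algebra endomorphisms $\varphi$ of $\mathfrak{n}_{d,t}$ such that $B_1(x,y)=B_2(\varphi(x),\varphi(y))$ for all $x,y$ and $\varphi(\mathrm{Ker}(B_1))\subseteq \mathrm{Ker}(B_2)$. Then $Hom(B_1,B_2)=MEnd_\perp(B_1,B_2)/\sim$, where $\varphi_1\sim\varphi_2$ iff $(\varphi_1-\varphi_2)(\mathfrak{n}_{d,t})\subseteq \mathrm{Ker}(B_2)$; composition is induced by composition of endomorphisms. *)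

(* Defs.v *)
From HB Require Import structures.
From mathcomp Require Import all_boot all_algebra.
From mathcomp Require Import boolp.

Set Implicit Arguments.
Unset Strict Implicit.
Unset Printing Implicit Defensive.

Import GRing.Theory.

Local Open Scope ring_scope.
Local Open Scope quotient_scope.

Record category := Category {
  obj :> Type;
  hom : obj -> obj -> Type;
  idm : forall X, hom X X;
  comp : forall X Y Z, hom Y Z -> hom X Y -> hom X Z;
  comp_idl : forall X Y (f : hom X Y), comp (idm Y) f = f;
  comp_idr : forall X Y (f : hom X Y), comp f (idm X) = f;
  comp_assoc : forall W X Y Z (h : hom Y Z) (g : hom X Y) (f : hom W X),
    comp h (comp g f) = comp (comp h g) f }.

Arguments hom {c} X Y.
Arguments idm {c} X.
Arguments comp {c X Y Z} g f.

Record cfunctor (C D : category) := Functor {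
  fobj :> C -> D;
  fmap : forall X Y : C, hom X Y -> hom (fobj X) (fobj Y);
  fmap_id : forall X : C, fmap (idm X) = idm (fobj X);
  fmap_comp : forall (X Y Z : C) (g : hom Y Z) (f : hom X Y),
    fmap (comp g f) = comp (fmap g) (fmap f) }.

Arguments fmap {C D} F {X Y} f : rename.

Definition functor_id (C : category) : cfunctor C C :=
  @Functor C C id (fun _ _ f => f) (fun _ => erefl) (fun _ _ _ _ _ => erefl).

Lemma functor_comp_id (C D E : category) (G : cfunctor D E) (F : cfunctor C D)
  (X : C) : fmap G (fmap F (idm X)) = idm (G (F X)).
Proof. by rewrite !fmap_id. Qed.

Lemma functor_comp_comp (C D E : category) (G : cfunctor D E)
    (F : cfunctor C D) (X Y Z : C) (g : hom Y Z) (f : hom X Y) :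
  fmap G (fmap F (comp g f)) = comp (fmap G (fmap F g)) (fmap G (fmap F f)).
Proof. by rewrite !fmap_comp. Qed.

Definition functor_comp (C D E : category) (G : cfunctor D E)
    (F : cfunctor C D) : cfunctor C E :=
  @Functor C E (fun X => G (F X)) (fun _ _ f => fmap G (fmap F f))
    (functor_comp_id G F) (@functor_comp_comp C D E G F).

Definition is_iso (C : category) (X Y : C) (f : hom X Y) : Prop :=
  exists g : hom Y X, comp g f = idm X /\ comp f g = idm Y.

Definition nat_isomorphic (C D : category) (F G : cfunctor C D) : Prop :=
  exists eta : forall X : C, hom (F X) (G X),
    (forall X, is_iso (eta X)) /\
    (forall X Y (f : hom X Y), comp (eta Y) (fmap F f) = comp (fmap G f) (eta X)).

Definition equivalent_categories (C D : category) : Prop :=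
  exists (F : cfunctor C D) (G : cfunctor D C),
    nat_isomorphic (functor_comp G F) (functor_id C) /\
    nat_isomorphic (functor_comp F G) (functor_id D).

HB.mixin Record Lmodule_isLieAlgebra (K : fieldType) (L : Type)
    of GRing.Lmodule K L := {
  lie_bracket : L -> L -> L;
  lie_bracketPl : forall z : L, linear (lie_bracket^~ z);
  lie_bracketPr : forall z : L, linear (lie_bracket z);
  lie_bracketxx : forall x : L, lie_bracket x x = 0;
  lie_jacobi : forall x y z : L,
    lie_bracket x (lie_bracket y z) + lie_bracket y (lie_bracket z x)
      + lie_bracket z (lie_bracket x y) = 0 }.

#[short(type="lieAlgType")]
HB.structure Definition LieAlgebra (K : fieldType) :=
  { L of GRing.Lmodule K L & Lmodule_isLieAlgebra K L }.

Notation "[ 'lie' x , y ]" := (lie_bracket x y)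
  (at level 0, format "[ 'lie'  x ,  y ]") : ring_scope.

Section LieTheory.
Variables (K : fieldType) (L : lieAlgType K).
Implicit Types (x y z : L) (a : K).

HB.instance Definition _ z :=
  GRing.isLinear.Build K L L _ (lie_bracket z) (lie_bracketPr z).

Lemma lie_bracketDl x y z : [lie x + y, z] = [lie x, z] + [lie y, z].
Proof. by have := lie_bracketPl z 1 x y; rewrite !scale1r. Qed.

Lemma lie_bracketDr x y z : [lie x, y + z] = [lie x, y] + [lie x, z].
Proof. exact: linearD. Qed.

Lemma lie_bracketC x y : [lie x, y] = - [lie y, x].
Proof.
have := lie_bracketxx (x + y).
rewrite lie_bracketDl !lie_bracketDr !lie_bracketxx add0r addr0.
by move/eqP; rewrite addr_eq0 => /eqP.
Qed.

End LieTheory.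

Record lie_hom (K : fieldType) (L M : lieAlgType K) := LieHom {
  lie_hom_fun :> L -> M;
  lie_hom_linear : linear lie_hom_fun;
  lie_homM : {morph lie_hom_fun : x y / [lie x, y]} }.

HB.instance Definition _ (K : fieldType) (L M : lieAlgType K)
    (f : lie_hom L M) :=
  GRing.isLinear.Build K L M _ (lie_hom_fun f) (lie_hom_linear f).

Section LieHom.
Variable K : fieldType.
Implicit Types L M N : lieAlgType K.

Lemma lie_hom0 L M (f : lie_hom L M) : f 0 = 0.
Proof. exact: raddf0. Qed.

Lemma lie_homD L M (f : lie_hom L M) x y : f (x + y) = f x + f y.
Proof. exact: raddfD. Qed.

Lemma lie_homZ L M (f : lie_hom L M) a x : f (a *: x) = a *: f x.
Proof. exact: linearZ. Qed.

Lemma lie_hom_eq L M (f g : lie_hom L M) : f =1 g -> f = g.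
Proof.
case: f g => [f fl fM] [g gl gM] /= /funext fg; subst g.
by rewrite (Prop_irrelevance fl gl) (Prop_irrelevance fM gM).
Qed.

Lemma lie_id_linear L : linear (@id L). Proof. by []. Qed.

Definition lie_id L : lie_hom L L :=
  @LieHom K L L id (@lie_id_linear L) (fun _ _ => erefl).

Lemma lie_comp_linear L M N (g : lie_hom M N) (f : lie_hom L M) :
  linear (g \o f).
Proof. by move=> a x y /=; rewrite !linearP. Qed.

Lemma lie_comp_morph L M N (g : lie_hom M N) (f : lie_hom L M) :
  {morph g \o f : x y / [lie x, y]}.
Proof. by move=> x y /=; rewrite !lie_homM. Qed.

Definition lie_comp L M N (g : lie_hom M N) (f : lie_hom L M) : lie_hom L N :=
  LieHom (lie_comp_linear g f) (@lie_comp_morph L M N g f).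

End LieHom.

HB.mixin Record isLieIdeal (K : fieldType) (L : lieAlgType K) (S : L -> bool) := {
  lie_idealZ : forall (a : K) (x : L), x \in S -> a *: x \in S;
  lie_idealMr : forall x y : L, x \in S -> [lie x, y] \in S }.

#[short(type="lieIdeal")]
HB.structure Definition LieIdeal (K : fieldType) (L : lieAlgType K) :=
  { S of GRing.ZmodClosed L S & isLieIdeal K L S }.

Section LieQuotient.
Variables (K : fieldType) (L : lieAlgType K) (I : lieIdeal L).
Local Notation Q := {ideal_quot I}.

Lemma lie_idealMl (x y : L) : x \in I -> [lie y, x] \in I.
Proof. by move=> xI; rewrite lie_bracketC rpredN; apply: lie_idealMr. Qed.

Lemma lie_quot_eqP (x y : L) : x - y \in I -> \pi_Q x = \pi_Q y.
Proof. by move=> xyI; apply/eqP; rewrite -Quotient.idealrBE. Qed.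

Lemma lie_quot_repr (x : L) : repr (\pi_Q x) - x \in I.
Proof. by rewrite Quotient.idealrBE reprK. Qed.

Definition lie_quot_scale (a : K) := lift_op1 Q (GRing.scale a).
Definition lie_quot_bracket := lift_op2 Q (@lie_bracket K L).

Lemma lie_quot_scaleE a (x : L) : lie_quot_scale a (\pi_Q x) = \pi_Q (a *: x).
Proof.
unlock lie_quot_scale; apply: lie_quot_eqP.
by rewrite -scalerBr lie_idealZ // lie_quot_repr.
Qed.

Lemma lie_quot_bracketE (x y : L) :
  lie_quot_bracket (\pi_Q x) (\pi_Q y) = \pi_Q [lie x, y].
Proof.
unlock lie_quot_bracket; apply: lie_quot_eqP; set x' := repr _; set y' := repr _.
have -> : [lie x', y'] - [lie x, y] = [lie x' - x, y'] + [lie x, y' - y].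
  rewrite linearB -[X in _ = X + _](addrK [lie x, y']) -lie_bracketDl subrK.
  by rewrite addrA subrK.
by apply: rpredD; [apply: lie_idealMr | apply: lie_idealMl]; apply: lie_quot_repr.
Qed.

Lemma lie_quot_pi0 : \pi_Q (0 : L) = 0.
Proof. exact: raddf0. Qed.

Lemma lie_quot_piD (x y : L) : \pi_Q (x + y) = \pi_Q x + \pi_Q y.
Proof. exact: raddfD. Qed.

Lemma lie_quot_scaleA a b (x : Q) :
  lie_quot_scale a (lie_quot_scale b x) = lie_quot_scale (a * b) x.
Proof. by elim/quotW: x => x; rewrite !lie_quot_scaleE scalerA. Qed.

Lemma lie_quot_scale1 : left_id 1 lie_quot_scale.
Proof. by elim/quotW=> x; rewrite lie_quot_scaleE scale1r. Qed.

Lemma lie_quot_scaleDr : right_distributive lie_quot_scale +%R.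
Proof.
move=> a x y; elim/quotW: x => x; elim/quotW: y => y.
by rewrite -lie_quot_piD !lie_quot_scaleE scalerDr lie_quot_piD.
Qed.

Lemma lie_quot_scaleDl (x : Q) : {morph lie_quot_scale^~ x : a b / a + b}.
Proof.
by move=> a b; elim/quotW: x => x; rewrite !lie_quot_scaleE scalerDl lie_quot_piD.
Qed.

HB.instance Definition _ := GRing.Zmodule.on Q.
HB.instance Definition _ := GRing.Zmodule_isLmodule.Build K Q
  lie_quot_scaleA lie_quot_scale1 lie_quot_scaleDr lie_quot_scaleDl.

Lemma lie_quot_piZ a (x : L) : \pi_Q (a *: x) = a *: \pi_Q x.
Proof. by rewrite -lie_quot_scaleE. Qed.

Lemma lie_quot_bracketPl (z : Q) : linear (lie_quot_bracket^~ z).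
Proof.
move=> a x y; elim/quotW: x => x; elim/quotW: y => y; elim/quotW: z => z.
rewrite -lie_quot_piZ -lie_quot_piD !lie_quot_bracketE lie_bracketPl lie_quot_piD.
by rewrite lie_quot_piZ.
Qed.

Lemma lie_quot_bracketPr (z : Q) : linear (lie_quot_bracket z).
Proof.
move=> a x y; elim/quotW: x => x; elim/quotW: y => y; elim/quotW: z => z.
rewrite -lie_quot_piZ -lie_quot_piD !lie_quot_bracketE lie_bracketPr lie_quot_piD.
by rewrite lie_quot_piZ.
Qed.

Lemma lie_quot_bracketxx (x : Q) : lie_quot_bracket x x = 0.
Proof.
by elim/quotW: x => x; rewrite lie_quot_bracketE lie_bracketxx lie_quot_pi0.
Qed.

Lemma lie_quot_jacobi (x y z : Q) :
  lie_quot_bracket x (lie_quot_bracket y z)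
    + lie_quot_bracket y (lie_quot_bracket z x)
    + lie_quot_bracket z (lie_quot_bracket x y) = 0.
Proof.
elim/quotW: x => x; elim/quotW: y => y; elim/quotW: z => z.
by rewrite !lie_quot_bracketE -!lie_quot_piD lie_jacobi lie_quot_pi0.
Qed.

HB.instance Definition _ := Lmodule_isLieAlgebra.Build K Q
  lie_quot_bracketPl lie_quot_bracketPr lie_quot_bracketxx lie_quot_jacobi.

Lemma lie_quot_piM (x y : L) : \pi_Q [lie x, y] = [lie \pi_Q x, \pi_Q y].
Proof. by rewrite -lie_quot_bracketE. Qed.

End LieQuotient.

Section LowerCentral.
Variables (K : fieldType) (L : lieAlgType K).

Definition bracket_space (U V : {pred L}) : {pred L} := fun z =>
  `[< exists (n : nat) (a : 'I_n -> K) (u v : 'I_n -> L),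
        [/\ forall i, u i \in U, forall i, v i \in V
          & z = \sum_(i < n) a i *: [lie u i, v i]] >].

(* [lower_central 1] is the whole algebra; the value at 0 is irrelevant. *)
Definition lower_central (i : nat) : {pred L} :=
  iter i.-1 (fun U => bracket_space U predT) predT.

Lemma bracket_space_closed (U V : {pred L}) : submod_closed (bracket_space U V).
Proof.
split.
  apply/asboolP; exists 0, (fun=> 0), (fun=> 0), (fun=> 0).
  by split; [case | case | rewrite big_ord0].
move=> c x y /asboolP[n [a [u [v [uU vV ->]]]]].
move=> /asboolP[m [b [u' [v' [uU' vV' ->]]]]]; apply/asboolP.
pose glue T (f : 'I_n -> T) (g : 'I_m -> T) (i : 'I_(n + m)) : T :=
  match split i with inl j => f j | inr j => g j end.
exists (n + m)%N, (glue _ (fun i => c * a i) b), (glue _ u u'), (glue _ v v').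
split=> [i|i|]; try by rewrite /glue; case: (split i).
rewrite scaler_sumr big_split_ord /=.
congr (_ + _); apply: eq_bigr => i _.
  by rewrite /glue -[lshift m i]/(unsplit (inl i)) unsplitK scalerA.
by rewrite /glue -[rshift n i]/(unsplit (inr i)) unsplitK.
Qed.

Lemma lower_central_closed i : submod_closed (lower_central i).
Proof.
by case: i => [|[|i]] //=; rewrite /lower_central /=; apply: bracket_space_closed.
Qed.

HB.instance Definition _ i :=
  GRing.isSubmodClosed.Build K L (lower_central i) (lower_central_closed i).

Lemma lower_central_scale i (a : K) (x : L) :
  x \in lower_central i -> a *: x \in lower_central i.
Proof. exact: rpredZ. Qed.

Lemma lower_central_bracket i (x y : L) :
  x \in lower_central i -> [lie x, y] \in lower_central i.
Proof.
have step (U : {pred L}) u v : u \in U -> [lie u, v] \in bracket_space U predT.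
  move=> uU; apply/asboolP; exists 1, (fun=> 1), (fun=> u), (fun=> v).
  by split=> //; rewrite big_ord1 scale1r.
elim: i x y => [//|[//|i] IH] x y xi; apply: (step (lower_central i.+1)).
have /asboolP[n [a [u [v [uU _ ->]]]]] := xi.
by apply: rpred_sum => j _; apply: rpredZ; apply: IH.
Qed.

HB.instance Definition _ i :=
  isLieIdeal.Build K L (lower_central i)
    (@lower_central_scale i) (@lower_central_bracket i).

Definition nilpotent_class (t : nat) : Prop :=
  (forall x : L, x \in lower_central t.+1 -> x = 0) /\
  (exists x : L, x \in lower_central t /\ x != 0).

(* [Vector.axiom d V] is a linear bijection of V with K^d; finite dimension of
   the whole algebra is not assumed, since it follows for nilpotent algebras. *)
Definition has_type (d : nat) : Prop :=
  inhabited (Vector.axiom d {ideal_quot (lower_central 2)}).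

End LowerCentral.

Arguments lower_central {K} L i.
Arguments nilpotent_class {K} L t.
Arguments has_type {K} L d.

(* The free Lie algebra on d generators is the algebra of Lie words in d
   letters modulo the congruence generated by the Lie algebra axioms. *)
Inductive lie_word (K : Type) (d : nat) : Type :=
  | WGen of 'I_d
  | WZero
  | WAdd of lie_word K d & lie_word K d
  | WScale of K & lie_word K d
  | WBracket of lie_word K d & lie_word K d.

Arguments WGen {K d}.
Arguments WZero {K d}.

HB.instance Definition _ K d := gen_eqMixin (lie_word K d).
HB.instance Definition _ K d := gen_choiceMixin (lie_word K d).

Section FreeLie.
Variables (K : fieldType) (d : nat).
Local Notation W := (lie_word K d).

Inductive lie_cong : W -> W -> Prop :=
  | cong_refl x : lie_cong x x
  | cong_sym x y : lie_cong x y -> lie_cong y x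
  | cong_trans x y z : lie_cong x y -> lie_cong y z -> lie_cong x z
  | cong_add x x' y y' :
      lie_cong x x' -> lie_cong y y' -> lie_cong (WAdd x y) (WAdd x' y')
  | cong_scale a x x' : lie_cong x x' -> lie_cong (WScale a x) (WScale a x')
  | cong_bracket x x' y y' :
      lie_cong x x' -> lie_cong y y' -> lie_cong (WBracket x y) (WBracket x' y')
  | cong_addA x y z : lie_cong (WAdd x (WAdd y z)) (WAdd (WAdd x y) z)
  | cong_addC x y : lie_cong (WAdd x y) (WAdd y x)
  | cong_add0 x : lie_cong (WAdd WZero x) x
  | cong_addN x : lie_cong (WAdd (WScale (-1) x) x) WZero
  | cong_scaleA a b x : lie_cong (WScale a (WScale b x)) (WScale (a * b) x)
  | cong_scale1 x : lie_cong (WScale 1 x) x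
  | cong_scaleDr a x y :
      lie_cong (WScale a (WAdd x y)) (WAdd (WScale a x) (WScale a y))
  | cong_scaleDl a b x :
      lie_cong (WScale (a + b) x) (WAdd (WScale a x) (WScale b x))
  | cong_bracketPl a x y z :
      lie_cong (WBracket (WAdd (WScale a x) y) z)
               (WAdd (WScale a (WBracket x z)) (WBracket y z))
  | cong_bracketPr a x y z :
      lie_cong (WBracket z (WAdd (WScale a x) y))
               (WAdd (WScale a (WBracket z x)) (WBracket z y))
  | cong_bracketxx x : lie_cong (WBracket x x) WZero
  | cong_jacobi x y z :
      lie_cong (WAdd (WAdd (WBracket x (WBracket y z))
                           (WBracket y (WBracket z x)))
                     (WBracket z (WBracket x y))) WZero.

Definition lie_congb : rel W := fun x y => `[< lie_cong x y >].

Lemma lie_congb_equiv : equiv_class_of lie_congb.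
Proof.
split=> [x|x y|y x z]; first exact/asboolP/cong_refl.
  by apply/asboolP/asboolP; apply: cong_sym.
by move=> /asboolP xy /asboolP yz; apply/asboolP; apply: cong_trans xy yz.
Qed.

Canonical lie_congb_equivRel := EquivRelPack lie_congb_equiv.
Canonical lie_congb_encModRel := defaultEncModRel lie_congb.

Definition free_lie := {eq_quot lie_congb}.

HB.instance Definition _ := Choice.on free_lie.
HB.instance Definition _ := EqQuotient.on free_lie.

Local Notation pi := (\pi_free_lie).

Lemma free_lie_eqP x y : pi x = pi y <-> lie_cong x y.
Proof. by split=> [/eqquotP/asboolP | xy] //; apply/eqquotP/asboolP. Qed.

Lemma free_lie_repr x : lie_cong (repr (pi x)) x.
Proof. by apply/free_lie_eqP; rewrite reprK. Qed.

Definition fl_zero : free_lie := pi WZero.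
Definition fl_add := lift_op2 free_lie (@WAdd K d).
Definition fl_scale (a : K) := lift_op1 free_lie (WScale a).
Definition fl_opp : free_lie -> free_lie := fl_scale (-1).
Definition fl_bracket := lift_op2 free_lie (@WBracket K d).

Lemma fl_addE x y : fl_add (pi x) (pi y) = pi (WAdd x y).
Proof.
by unlock fl_add; apply/free_lie_eqP/cong_add; apply: free_lie_repr.
Qed.

Lemma fl_scaleE a x : fl_scale a (pi x) = pi (WScale a x).
Proof.
by unlock fl_scale; apply/free_lie_eqP/cong_scale/free_lie_repr.
Qed.

Lemma fl_bracketE x y : fl_bracket (pi x) (pi y) = pi (WBracket x y).
Proof.
by unlock fl_bracket; apply/free_lie_eqP/cong_bracket; apply: free_lie_repr.
Qed.

Let flE := (fl_addE, fl_scaleE, fl_bracketE).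

Lemma fl_addA : associative fl_add.
Proof.
elim/quotW=> x; elim/quotW=> y; elim/quotW=> z.
by rewrite !flE; apply/free_lie_eqP/cong_addA.
Qed.

Lemma fl_addC : commutative fl_add.
Proof.
by elim/quotW=> x; elim/quotW=> y; rewrite !flE; apply/free_lie_eqP/cong_addC.
Qed.

Lemma fl_add0 : left_id fl_zero fl_add.
Proof. by elim/quotW=> x; rewrite !flE; apply/free_lie_eqP/cong_add0. Qed.

Lemma fl_addN : left_inverse fl_zero fl_opp fl_add.
Proof.
by elim/quotW=> x; rewrite /fl_opp !flE; apply/free_lie_eqP/cong_addN.
Qed.

HB.instance Definition _ :=
  GRing.isZmodule.Build free_lie fl_addA fl_addC fl_add0 fl_addN.

Lemma fl_piD x y : pi (WAdd x y) = pi x + pi y.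
Proof. by rewrite -fl_addE. Qed.

Lemma fl_scaleA a b (x : free_lie) :
  fl_scale a (fl_scale b x) = fl_scale (a * b) x.
Proof.
by elim/quotW: x => x; rewrite !flE; apply/free_lie_eqP/cong_scaleA.
Qed.

Lemma fl_scale1 : left_id 1 fl_scale.
Proof. by elim/quotW=> x; rewrite !flE; apply/free_lie_eqP/cong_scale1. Qed.

Lemma fl_scaleDr : right_distributive fl_scale +%R.
Proof.
move=> a; elim/quotW=> x; elim/quotW=> y.
by rewrite -!fl_piD !flE -fl_piD; apply/free_lie_eqP/cong_scaleDr.
Qed.

Lemma fl_scaleDl (x : free_lie) : {morph fl_scale^~ x : a b / a + b}.
Proof.
move=> a b; elim/quotW: x => x.
by rewrite !flE -fl_piD; apply/free_lie_eqP/cong_scaleDl.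
Qed.

HB.instance Definition _ := GRing.Zmodule_isLmodule.Build K free_lie
  fl_scaleA fl_scale1 fl_scaleDr fl_scaleDl.

Lemma fl_piZ a x : pi (WScale a x) = a *: pi x.
Proof. by rewrite -fl_scaleE. Qed.

Lemma fl_bracketPl (z : free_lie) : linear (fl_bracket^~ z).
Proof.
move=> a; elim/quotW=> x; elim/quotW=> y; elim/quotW: z => z.
rewrite -fl_piZ -fl_piD !flE -fl_piZ -fl_piD.
exact/free_lie_eqP/cong_bracketPl.
Qed.

Lemma fl_bracketPr (z : free_lie) : linear (fl_bracket z).
Proof.
move=> a; elim/quotW=> x; elim/quotW=> y; elim/quotW: z => z.
rewrite -fl_piZ -fl_piD !flE -fl_piZ -fl_piD.
exact/free_lie_eqP/cong_bracketPr.
Qed.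

Lemma fl_bracketxx (x : free_lie) : fl_bracket x x = 0.
Proof. by elim/quotW: x => x; rewrite flE; apply/free_lie_eqP/cong_bracketxx. Qed.

Lemma fl_jacobi (x y z : free_lie) :
  fl_bracket x (fl_bracket y z) + fl_bracket y (fl_bracket z x)
    + fl_bracket z (fl_bracket x y) = 0.
Proof.
elim/quotW: x => x; elim/quotW: y => y; elim/quotW: z => z.
by rewrite !flE -!fl_piD; apply/free_lie_eqP/cong_jacobi.
Qed.

HB.instance Definition _ := Lmodule_isLieAlgebra.Build K free_lie
  fl_bracketPl fl_bracketPr fl_bracketxx fl_jacobi.

Lemma fl_piM x y : pi (WBracket x y) = [lie pi x, pi y].
Proof. by rewrite -fl_bracketE. Qed.

Definition fl_gen (i : 'I_d) : free_lie := pi (WGen i).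

Lemma fl_gen_hom_eq (L : lieAlgType K) (f g : lie_hom free_lie L) :
  (forall i, f (fl_gen i) = g (fl_gen i)) -> f = g.
Proof.
move=> fg; apply: lie_hom_eq; elim/quotW.
elim=> [//||x IHx y IHy|a x IHx|x IHx y IHy].
- by rewrite -[pi WZero]/(0 : free_lie) !lie_hom0.
- by rewrite fl_piD !lie_homD IHx IHy.
- by rewrite fl_piZ !lie_homZ IHx.
- by rewrite fl_piM !lie_homM IHx IHy.
Qed.

Section Lift.
Variables (L : lieAlgType K) (e : 'I_d -> L).

Fixpoint word_eval (w : W) : L :=
  match w with
  | WGen i => e i
  | WZero => 0
  | WAdd x y => word_eval x + word_eval y
  | WScale a x => a *: word_eval x
  | WBracket x y => [lie word_eval x, word_eval y]
  end.

Lemma word_eval_cong x y : lie_cong x y -> word_eval x = word_eval y.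
Proof.
elim=> //= {x y}.
- by move=> x y z _ ->.
- by move=> x x' y y' _ -> _ ->.
- by move=> a x x' _ ->.
- by move=> x x' y y' _ -> _ ->.
- by move=> *; rewrite addrA.
- by move=> *; rewrite addrC.
- by move=> *; rewrite add0r.
- by move=> *; rewrite scaleN1r addNr.
- by move=> *; rewrite scalerA.
- by move=> *; rewrite scale1r.
- by move=> *; rewrite scalerDr.
- by move=> *; rewrite scalerDl.
- by move=> *; rewrite lie_bracketPl.
- by move=> *; rewrite lie_bracketPr.
- by move=> *; rewrite lie_bracketxx.
- by move=> *; rewrite lie_jacobi.
Qed.

Definition fl_lift_fun (x : free_lie) : L := word_eval (repr x).

Lemma fl_lift_funE w : fl_lift_fun (pi w) = word_eval w.
Proof. exact/word_eval_cong/free_lie_repr. Qed.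

Lemma fl_lift_linear : linear fl_lift_fun.
Proof.
move=> a; elim/quotW=> x; elim/quotW=> y.
by rewrite -fl_piZ -fl_piD !fl_lift_funE.
Qed.

Lemma fl_lift_morph : {morph fl_lift_fun : x y / [lie x, y]}.
Proof.
by elim/quotW=> x; elim/quotW=> y; rewrite -fl_piM !fl_lift_funE.
Qed.

Definition fl_lift : lie_hom free_lie L := LieHom fl_lift_linear fl_lift_morph.

Lemma fl_lift_gen i : fl_lift (fl_gen i) = e i.
Proof. exact: fl_lift_funE. Qed.

End Lift.
End FreeLie.

Definition free_nilpotent (K : fieldType) (d t : nat) : lieAlgType K :=
  {ideal_quot (lower_central (free_lie K d) t.+1)}.

Section Forms.
Variables (K : fieldType) (L : lieAlgType K).

Definition invariant_form (B : {symmetric L}) : Prop :=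
  forall x y z : L, B [lie x, y] z = B x [lie y, z].

Definition form_ker (B : {symmetric L}) : {pred L} :=
  fun x => `[< forall y : L, B x y = 0 >].

Definition nondegenerate_form (B : {symmetric L}) : Prop :=
  forall x : L, x \in form_ker B -> x = 0.

Lemma form_ker0 (B : {symmetric L}) : 0 \in form_ker B.
Proof. by apply/asboolP => z; exact: linear0l. Qed.

Lemma form_kerD (B : {symmetric L}) x y :
  x \in form_ker B -> y \in form_ker B -> x + y \in form_ker B.
Proof.
move=> /asboolP xB /asboolP yB; apply/asboolP => z.
by apply: etrans (linearDl B z x y) _; rewrite /= xB yB addr0.
Qed.

Lemma form_kerN (B : {symmetric L}) x : x \in form_ker B -> - x \in form_ker B.
Proof.
move=> /asboolP xB; apply/asboolP => z.
by apply: etrans (linearNl B z x) _; rewrite /= xB oppr0.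
Qed.

End Forms.

Section NilpQuad.
Variables (K : fieldType) (d t : nat).

Record nilp_quad := NilpQuadObj {
  nq_lie :> lieAlgType K;
  nq_form : {symmetric nq_lie};
  nq_invariant : invariant_form nq_form;
  nq_nondegenerate : nondegenerate_form nq_form;
  nq_nilpotent : nilpotent_class nq_lie t;
  nq_type : has_type nq_lie d }.

Record nilp_quad_hom (N N' : nilp_quad) := NilpQuadHom {
  nq_hom :> lie_hom N N';
  nq_hom_isometry : forall x y : N,
    nq_form N x y = nq_form N' (nq_hom x) (nq_hom y) }.

Lemma nilp_quad_hom_eq N N' (f g : nilp_quad_hom N N') : f =1 g -> f = g.
Proof.
case: f g => [f fB] [g gB] /= /lie_hom_eq fg; subst g.
by rewrite (Prop_irrelevance fB gB).
Qed.

Definition nilp_quad_id N : nilp_quad_hom N N :=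
  @NilpQuadHom N N (lie_id N) (fun _ _ => erefl).

Lemma nilp_quad_comp_isometry N1 N2 N3 (g : nilp_quad_hom N2 N3)
    (f : nilp_quad_hom N1 N2) (x y : N1) :
  nq_form N1 x y = nq_form N3 (lie_comp g f x) (lie_comp g f y).
Proof. by rewrite (nq_hom_isometry f) (nq_hom_isometry g). Qed.

Definition nilp_quad_comp N1 N2 N3 (g : nilp_quad_hom N2 N3)
    (f : nilp_quad_hom N1 N2) : nilp_quad_hom N1 N3 :=
  NilpQuadHom (nilp_quad_comp_isometry g f).

Definition NilpQuad : category.
Proof.
by refine (@Category nilp_quad nilp_quad_hom nilp_quad_id nilp_quad_comp
  _ _ _) => *; apply: nilp_quad_hom_eq.
Defined.

End NilpQuad.

Section Sym0.
Variables (K : fieldType) (d t : nat).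
Local Notation n_dt := (free_nilpotent K d t).

Record sym0 := Sym0Obj {
  s0_form :> {symmetric n_dt};
  s0_invariant : invariant_form s0_form;
  s0_ker_sub : {subset form_ker s0_form <= lower_central n_dt 2};
  s0_ker_top : ~ {subset lower_central n_dt t <= form_ker s0_form} }.

Record metric_end (B1 B2 : sym0) := MetricEnd {
  me_hom :> lie_hom n_dt n_dt;
  me_isometry : forall x y : n_dt, B1 x y = B2 (me_hom x) (me_hom y);
  me_ker : forall x : n_dt, x \in form_ker B1 -> me_hom x \in form_ker B2 }.

HB.instance Definition _ B1 B2 := gen_eqMixin (metric_end B1 B2).
HB.instance Definition _ B1 B2 := gen_choiceMixin (metric_end B1 B2).

Definition me_id B : metric_end B B :=
  @MetricEnd B B (lie_id n_dt) (fun _ _ => erefl) (fun _ xB => xB).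

Lemma me_comp_isometry B1 B2 B3 (g : metric_end B2 B3) (f : metric_end B1 B2)
  (x y : n_dt) : B1 x y = B3 (lie_comp g f x) (lie_comp g f y).
Proof. by rewrite (me_isometry f) (me_isometry g). Qed.

Lemma me_comp_ker B1 B2 B3 (g : metric_end B2 B3) (f : metric_end B1 B2)
  (x : n_dt) : x \in form_ker B1 -> lie_comp g f x \in form_ker B3.
Proof. by move=> xB; do 2!apply: me_ker. Qed.

Definition me_comp B1 B2 B3 (g : metric_end B2 B3) (f : metric_end B1 B2) :
    metric_end B1 B3 :=
  MetricEnd (me_comp_isometry g f) (@me_comp_ker B1 B2 B3 g f).

Section Quotient.
Variables B1 B2 : sym0.

Definition me_equiv : rel (metric_end B1 B2) := fun f g =>
  `[< forall x : n_dt, f x - g x \in form_ker B2 >].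

Lemma me_equiv_class : equiv_class_of me_equiv.
Proof.
have sym f g : me_equiv f g -> me_equiv g f.
  move=> /asboolP fg; apply/asboolP => x; rewrite -opprB.
  exact: form_kerN.
split=> [f|f g|g f h].
- by apply/asboolP => x; rewrite subrr form_ker0.
- by apply/idP/idP; apply: sym.
move=> /asboolP fg /asboolP gh; apply/asboolP => x.
by rewrite -[f x](subrK (g x)) -addrA form_kerD.
Qed.

Canonical me_equivRel := EquivRelPack me_equiv_class.
Canonical me_encModRel := defaultEncModRel me_equiv.

Definition sym0_hom := {eq_quot me_equiv}.

HB.instance Definition _ := Choice.on sym0_hom.
HB.instance Definition _ := EqQuotient.on sym0_hom.

Lemma sym0_homP (f g : metric_end B1 B2) :
  \pi_sym0_hom f = \pi_sym0_hom g <->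
  (forall x : n_dt, f x - g x \in form_ker B2).
Proof. by split=> [/eqquotP/asboolP | fg] //; apply/eqquotP/asboolP. Qed.

Lemma sym0_hom_eq1 (f g : metric_end B1 B2) :
  f =1 g -> \pi_sym0_hom f = \pi_sym0_hom g.
Proof. by move=> fg; apply/sym0_homP => x; rewrite fg subrr form_ker0. Qed.

End Quotient.

Definition sym0_id B : sym0_hom B B := \pi_(sym0_hom B B) (me_id B).

Definition sym0_comp B1 B2 B3 (g : sym0_hom B2 B3) (f : sym0_hom B1 B2) :
  sym0_hom B1 B3 := \pi_(sym0_hom B1 B3) (me_comp (repr g) (repr f)).

Lemma sym0_compE B1 B2 B3 (g : metric_end B2 B3) (f : metric_end B1 B2) :
  sym0_comp (\pi_(sym0_hom B2 B3) g) (\pi_(sym0_hom B1 B2) f) =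
  \pi_(sym0_hom B1 B3) (me_comp g f).
Proof.
apply/sym0_homP => x /=; set g' := repr _; set f' := repr _.
have fP y : f' y - f y \in form_ker B2 by apply/sym0_homP: y; rewrite reprK.
have gP y : g' y - g y \in form_ker B3 by apply/sym0_homP: y; rewrite reprK.
rewrite -[g' (f' x)](subrK (g (f' x))) -addrA -linearB.
by apply: form_kerD => //; apply: me_ker.
Qed.

Lemma sym0_comp_idl B1 B2 (f : sym0_hom B1 B2) : sym0_comp (sym0_id B2) f = f.
Proof.
elim/quotW: f => f; rewrite sym0_compE; exact: sym0_hom_eq1.
Qed.

Lemma sym0_comp_idr B1 B2 (f : sym0_hom B1 B2) : sym0_comp f (sym0_id B1) = f.
Proof.
elim/quotW: f => f; rewrite sym0_compE; exact: sym0_hom_eq1.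
Qed.

Lemma sym0_compA B1 B2 B3 B4 (h : sym0_hom B3 B4) (g : sym0_hom B2 B3)
    (f : sym0_hom B1 B2) :
  sym0_comp h (sym0_comp g f) = sym0_comp (sym0_comp h g) f.
Proof.
elim/quotW: f => f; elim/quotW: g => g; elim/quotW: h => h.
rewrite (sym0_compE g f) (sym0_compE h g) !sym0_compE.
exact: sym0_hom_eq1.
Qed.

Definition Sym0 : category :=
  Category sym0_comp_idl sym0_comp_idr sym0_compA.

End Sym0.

(* Main.v *)
(** Call a surjective Lie homomorphism [p : n_{d,t} -> N] with
    [B x y = B_N (p x) (p y)] a presentation of the quadratic algebra [N] by the
    form [B]; nondegeneracy of [B_N] forces [ker p = Ker B].  Each [B] presents
    the quotient [n_{d,t} / Ker B], and each [N] is presented by the pull-back of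
    [B_N] along the map sending the free generators to lifts of a basis of
    [N / N^2], which is onto because [N] is nilpotent.  Given presentations
    [p1], [p2], metric endomorphisms descend to isometric homomorphisms
    [N1 -> N2]; since [n_{d,t}] is free among nilpotent algebras of class at
    most [t], every such homomorphism lifts, and two lifts differ by a map into
    [ker p2 = Ker B2].  So [B |-> N] is fully faithful and essentially
    surjective. *)

From HB Require Import structures.
From mathcomp Require Import all_boot all_algebra.
From mathcomp Require Import boolp.
Require Import Defs.

Set Implicit Arguments.
Unset Strict Implicit.
Unset Printing Implicit Defensive.

Import GRing.Theory.

Local Open Scope ring_scope.
Local Open Scope quotient_scope.

(** * Choice, and a criterion for equivalence of categories *)

Lemma dep_choice (A : Type) (T : A -> Type) (P : forall a, T a -> Prop) :
  (forall a, exists b, P a b) -> exists f : forall a, T a, forall a, P a (f a).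
Proof.
by move=> AP; exists (fun a => projT1 (cid (AP a))) => a; case: cid.
Qed.

(** The quasi-inverse picks for each [Z] an object [Gob Z] with an isomorphism [e Z], and sends a
    morphism to the lift of its conjugate by these isomorphisms; faithfulness gives the functor
    laws. *)
Lemma fully_faithful_equivalence (C D : category) (F : cfunctor C D) :
    (forall (X Y : C) (g : hom (F X) (F Y)), exists f : hom X Y, fmap F f = g) ->
    (forall (X Y : C) (f g : hom X Y), fmap F f = fmap F g -> f = g) ->
    (forall Z : D, exists (X : C) (e : hom (F X) Z), is_iso e) ->
  equivalent_categories C D.
Proof.
move=> full faithful /dep_choice[Gob /dep_choice[e /dep_choice[e' eK]]].
have e'K Z : comp (e' Z) (e Z) = idm _ by case: (eK Z).
have {}eK Z : comp (e Z) (e' Z) = idm _ by case: (eK Z).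
have Gmap Z W (f : hom Z W) := cid (full _ _ (comp (e' W) (comp f (e Z)))).
pose gmap Z W f := sval (Gmap Z W f).
have FgE Z W f : fmap F (gmap Z W f) = comp (e' W) (comp f (e Z)).
  exact: svalP (Gmap Z W f).
have gmap_id Z : gmap Z Z (idm Z) = idm (Gob Z).
  by apply: faithful; rewrite FgE comp_idl fmap_id.
have gmap_comp U V W (g : hom V W) (f : hom U V) :
    gmap U W (comp g f) = comp (gmap V W g) (gmap U V f).
  apply: faithful; rewrite fmap_comp !FgE -!comp_assoc.
  by rewrite [comp (e V) _]comp_assoc eK comp_idl.
pose G : cfunctor D C := Functor gmap_id gmap_comp.
(* One natural isomorphism is [e] itself; the other is the lift through [F] of its components at the
   objects [F X]. *)
have /dep_choice[eta etaE] X : exists f : hom (Gob (F X)) X, fmap F f = e (F X).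
  exact: full.
have /dep_choice[eta' eta'E] X :
    exists f : hom X (Gob (F X)), fmap F f = e' (F X) by exact: full.
exists F, G; split.
  exists eta; split=> [X|X Y f].
    exists (eta' X); split; apply: faithful;
    by rewrite fmap_comp etaE eta'E fmap_id ?e'K ?eK.
  by apply: faithful; rewrite !fmap_comp !etaE /= FgE comp_assoc eK comp_idl.
exists e; split=> [Z|Z W f]; first by exists (e' Z); rewrite eK e'K.
by rewrite /= FgE comp_assoc eK comp_idl.
Qed.

(** * Homomorphisms, quotients and the lower central series *)

Section LieHomFacts.
Variable K : fieldType.
Implicit Types L M N : lieAlgType K.

Definition lie_surj L M (p : lie_hom L M) := forall y, exists x, p x = y.

Lemma lie_homB L M (f : lie_hom L M) x y : f (x - y) = f x - f y.
Proof. exact: raddfB. Qed.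

Lemma lie_hom_sum L M (f : lie_hom L M) n (F : 'I_n -> L) :
  f (\sum_(i < n) F i) = \sum_(i < n) f (F i).
Proof. exact: raddf_sum. Qed.

(** Composing [g] with any section of [p] works: two preimages of a point differ by an element that
    [p], hence [g], kills, so the choice of section is immaterial. *)
Lemma lie_hom_descend L M N (p : lie_hom L M) (g : lie_hom L N) :
    lie_surj p -> (forall x, p x = 0 -> g x = 0) ->
  exists h : lie_hom M N, forall x, h (p x) = g x.
Proof.
move=> /dep_choice[s sK] pg; pose h y := g (s y).
have hp x : h (p x) = g x.
  by apply/eqP; rewrite -subr_eq0 -lie_homB pg // lie_homB sK subrr.
have hl : linear h.
  move=> a x y; rewrite -(sK x) -(sK y) -lie_homZ -lie_homD !hp.
  by rewrite lie_homD lie_homZ.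
have hM : {morph h : x y / [lie x, y]}.
  by move=> x y; rewrite -(sK x) -(sK y) -lie_homM !hp lie_homM.
by exists (LieHom hl hM).
Qed.

Section Quot.
Variables (L : lieAlgType K) (I : lieIdeal L).
Local Notation Q := {ideal_quot I}.

Lemma lie_pi_linear : linear (\pi_Q : L -> Q).
Proof. by move=> a x y; rewrite lie_quot_piD lie_quot_piZ. Qed.

Definition lie_pi : lie_hom L Q := LieHom lie_pi_linear (@lie_quot_piM K L I).

Lemma lie_pi_surj : lie_surj lie_pi.
Proof. by elim/quotW=> x; exists x. Qed.

Lemma lie_pi_eq0 x : lie_pi x = 0 <-> x \in I.
Proof.
rewrite -[x in x \in I]subr0 Quotient.idealrBE lie_quot_pi0.
by split=> /eqP.
Qed.

End Quot.

Lemma lower_central_bracketS L i (x y : L) :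
  x \in lower_central L i -> [lie x, y] \in lower_central L i.+1.
Proof.
case: i => [//|i] xi; apply/asboolP; exists 1, (fun=> 1), (fun=> x), (fun=> y).
by split=> //; rewrite big_ord1 scale1r.
Qed.

Lemma lower_centralSP L i (x : L) : x \in lower_central L i.+2 ->
  exists (n : nat) (a : 'I_n -> K) (u v : 'I_n -> L),
    (forall j, u j \in lower_central L i.+1) /\
    x = \sum_(j < n) a j *: [lie u j, v j].
Proof. by case/asboolP=> n [a [u [v [uU _ xE]]]]; exists n, a, u, v. Qed.

Lemma lower_central_sub L i (x : L) :
  x \in lower_central L i.+1 -> x \in lower_central L i.
Proof.
case: i => [//|i] /lower_centralSP[n [a [u [v [uU ->]]]]].
by apply: rpred_sum => j _; apply/lower_central_scale/lower_central_bracket.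
Qed.

Lemma lower_central_hom L M (f : lie_hom L M) i x :
  x \in lower_central L i -> f x \in lower_central M i.
Proof.
case: i => [//|i]; elim: i x => [//|i IH] x.
case/lower_centralSP=> n [a [u [v [uU ->]]]]; rewrite lie_hom_sum.
apply: rpred_sum => j _; rewrite lie_homZ lie_homM.
by apply/lower_central_scale/lower_central_bracketS/IH.
Qed.

(** Induction on [i]: in a sum of brackets the left factors lift into the preceding term of the
    series, the right ones through any section of [f]. *)
Lemma lower_central_surj L M (f : lie_hom L M) i y : lie_surj f ->
  y \in lower_central M i -> exists2 x, x \in lower_central L i & f x = y.
Proof.
move=> fs; have [s sK] := dep_choice fs.
case: i => [|i]; first by exists (s y).
elim: i y => [|i IH] y; first by exists (s y).
case/lower_centralSP=> n [a [u [v [uU ->]]]].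
have /dep_choice[u' u'P] j : exists x, x \in lower_central L i.+1 /\ f x = u j.
  by have [x] := IH _ (uU j); exists x.
exists (\sum_(j < n) a j *: [lie u' j, s (v j)]).
  apply: rpred_sum => j _; apply/lower_central_scale/lower_central_bracketS.
  by case: (u'P j).
rewrite lie_hom_sum; apply: eq_bigr => j _.
by rewrite lie_homZ lie_homM sK; case: (u'P j) => _ ->.
Qed.

(** By the Jacobi identity, bracketing with [[u, v]] amounts to bracketing with [u] and [v] in turn,
    in both orders, which goes two steps down the series. *)
Lemma lower_central_bracket2 L i (x y : L) :
    x \in lower_central L i -> y \in lower_central L 2 ->
  [lie x, y] \in lower_central L i.+2.
Proof.
move=> xi /lower_centralSP[n [a [u [v [_ ->]]]]]; rewrite linear_sum /=.
apply: rpred_sum => j _; rewrite linearZ /=; apply: lower_central_scale.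
have /eqP := lie_jacobi x (u j) (v j).
rewrite -addrA addr_eq0 => /eqP->; rewrite rpredN.
rewrite lie_bracketC [X in _ + X]lie_bracketC -opprD rpredN.
apply: rpredD; apply: lower_central_bracketS; last exact: lower_central_bracketS.
by rewrite lie_bracketC rpredN lower_central_bracketS.
Qed.

(* Modulo [N^(i+1)], a bracket [u, v] with [u] in [N^i] only depends on [u]
   modulo [N^(i+1)] and on [v] modulo [N^2], so both can be taken in the image. *)
Lemma nilpotent_surj L N (p : lie_hom L N) t :
    (forall x : N, x \in lower_central N t.+1 -> x = 0) ->
    (forall y, exists x, y - p x \in lower_central N 2) ->
  lie_surj p.
Proof.
move=> N0 p2.
have step i y : y \in lower_central N i.+1 ->
    exists x, y - p x \in lower_central N i.+2.
  elim: i y => [|i IH] y; first by move=> _; apply: p2.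
  case/lower_centralSP=> n [a [u [v [uU ->]]]].
  have [u' u'P] := dep_choice (fun j => IH _ (uU j)).
  have [v' v'P] := dep_choice (fun j => p2 (v j)).
  exists (\sum_(j < n) a j *: [lie u' j, v' j]).
  rewrite lie_hom_sum -sumrB; apply: rpred_sum => j _.
  rewrite lie_homZ -scalerBr lie_homM; apply: lower_central_scale.
  have -> : [lie u j, v j] - [lie p (u' j), p (v' j)] =
      [lie u j - p (u' j), v j] + [lie p (u' j), v j - p (v' j)].
    rewrite linearB -[X in _ = X + _](addrK [lie p (u' j), v j]).
    by rewrite -lie_bracketDl subrK addrA subrK.
  apply: rpredD; first exact: lower_central_bracketS.
  apply: lower_central_bracket2 => //.
  rewrite -[p _](subKr (u j)); apply: rpredB => //.
  exact: lower_central_sub.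
(* Each use of [step] pushes the remainder one term deeper; after [t] corrections it lies in
   [N^(t+1) = 0]. *)
have approx i y : exists x, y - p x \in lower_central N i.+1.
  elim: i y => [|i IH] y; first by exists 0.
  have [x1 /step[x2 yx]] := IH y.
  by exists (x1 + x2); rewrite lie_homD opprD addrA.
move=> y; have [x /N0/eqP] := approx t y.
by rewrite subr_eq0 => /eqP; exists x.
Qed.

End LieHomFacts.

(** * The abelian algebra on [K^d] as a model of the abelianization *)

Definition abelian_lie (K : fieldType) (d : nat) := 'rV[K]_d.

Section Abelian.
Variables (K : fieldType) (d : nat).
Local Notation A := (abelian_lie K d).

HB.instance Definition _ := GRing.Lmodule.on A.

Definition abelian_bracket (x y : A) : A := 0.

Lemma abelian_bracketPl (z : A) : linear (abelian_bracket^~ z).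
Proof. by move=> a x y; rewrite /abelian_bracket scaler0 addr0. Qed.

Lemma abelian_bracketPr (z : A) : linear (abelian_bracket z).
Proof. by move=> a x y; rewrite /abelian_bracket scaler0 addr0. Qed.

Lemma abelian_jacobi (x y z : A) :
  abelian_bracket x (abelian_bracket y z)
    + abelian_bracket y (abelian_bracket z x)
    + abelian_bracket z (abelian_bracket x y) = 0.
Proof. by rewrite /abelian_bracket !addr0. Qed.

HB.instance Definition _ := Lmodule_isLieAlgebra.Build K A
  abelian_bracketPl abelian_bracketPr (fun _ => erefl) abelian_jacobi.

Lemma abelian_lower_central2 (x : A) : x \in lower_central A 2 -> x = 0.
Proof.
case/lower_centralSP=> n [a [u [v [_ ->]]]].
by apply: big1 => j _; apply: scaler0.
Qed.

(** This makes [A] an admissible target for maps out of [n_{d,t}]. The bound on [t] matters, since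
    [lower_central A 1] is all of [A]. *)
Lemma abelian_lower_central t (x : A) :
  (1 <= t)%N -> x \in lower_central A t.+1 -> x = 0.
Proof.
case: t => [//|t] _; elim: t => [|t IH]; first exact: abelian_lower_central2.
by move=> /lower_central_sub.
Qed.

Definition abelian_gen (i : 'I_d) : A := delta_mx 0 i.

Lemma lie_hom_abelian (M : lieAlgType K) (e : 'I_d -> M) :
    (forall x y : M, [lie x, y] = 0) ->
  exists f : lie_hom A M, forall i, f (abelian_gen i) = e i.
Proof.
move=> M0; pose f (x : A) := \sum_i (x : 'rV_d) 0 i *: e i.
have fl : linear f.
  move=> a x y; rewrite /f scaler_sumr -big_split; apply: eq_bigr => i _ /=.
  by rewrite !mxE scalerDl scalerA.
have fM : {morph f : x y / [lie x, y]}.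
  by move=> x y; rewrite M0 /f big1 // => i _; rewrite mxE scale0r.
exists (LieHom fl fM) => i /=; rewrite /f (bigD1 i) //= mxE !eqxx scale1r.
by rewrite big1 ?addr0 // => j /negPf ji; rewrite mxE ji andbF scale0r.
Qed.

(** Coordinates on [L / L^2] are traded for a homomorphism out of [L] itself, so that types can be
    compared by composing and factoring homomorphisms. *)
Lemma has_typeP (L : lieAlgType K) : has_type L d <->
  exists q : lie_hom L A,
    lie_surj q /\ forall x, q x = 0 <-> x \in lower_central L 2.
Proof.
split=> [[[v vl [w vK wK]]]|[q [qs q0]]].
  pose piL := lie_pi (lower_central L 2).
  pose q (x : L) : A := v (piL x).
  have ql : linear q by move=> a x y; rewrite /q lie_homD lie_homZ vl.
  have v0 : v 0 = 0 by rewrite -[X in v X](subrr 0) -scaleN1r addrC vl scaleN1r addNr.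
  have q0 x : q x = 0 <-> x \in lower_central L 2.
    rewrite -lie_pi_eq0 /q; split=> [|->//].
    by rewrite -[RHS]v0; apply: (can_inj vK).
  have qM : {morph q : x y / [lie x, y]}.
    by move=> x y; apply/q0/lower_central_bracketS.
  exists (LieHom ql qM); split=> // y /=.
  by have [x xE] := lie_pi_surj (w y); exists x; rewrite /q xE wK.
have ps := @lie_pi_surj K L (lower_central L 2).
have [|h hE] := @lie_hom_descend K _ _ _ (lie_pi (lower_central L 2)) q ps.
  by move=> x /lie_pi_eq0/q0.
constructor; exists (h : _ -> 'rV_d); first exact: (lie_hom_linear h).
have /dep_choice[w wK] y : exists x, h x = y.
  by have [x <-] := qs y; exists (lie_pi (lower_central L 2) x).
exists w => // x; apply/eqP; rewrite -subr_eq0; apply/eqP.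
have : h (w (h x) - x) = 0 by rewrite lie_homB wK subrr.
by have [z <-] := ps (w (h x) - x); rewrite hE => /q0/lie_pi_eq0.
Qed.

End Abelian.

(** * The universal property of the free nilpotent algebra *)

Section FreeNilpotent.
Variables (K : fieldType) (d t : nat).
Local Notation n_dt := (free_nilpotent K d t).

Definition fn_pi : lie_hom (free_lie K d) n_dt := lie_pi (lower_central _ t.+1).
Definition fn_gen (i : 'I_d) : n_dt := fn_pi (fl_gen K i).

Lemma fn_lower_central (x : n_dt) : x \in lower_central n_dt t.+1 -> x = 0.
Proof.
move/(lower_central_surj (@lie_pi_surj K _ (lower_central _ t.+1))).
by case=> y yt <-; apply/lie_pi_eq0.
Qed.

Lemma fn_hom_eq (L : lieAlgType K) (f g : lie_hom n_dt L) :
  (forall i, f (fn_gen i) = g (fn_gen i)) -> f =1 g.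
Proof.
move=> fg x; have [y <-] : exists y, fn_pi y = x by apply: lie_pi_surj.
suff E : lie_comp f fn_pi = lie_comp g fn_pi.
  by have := congr1 (fun h : lie_hom _ _ => h y) E.
exact: fl_gen_hom_eq.
Qed.

Lemma fn_lift (L : lieAlgType K) (e : 'I_d -> L) :
    (forall x : L, x \in lower_central L t.+1 -> x = 0) ->
  exists f : lie_hom n_dt L, forall i, f (fn_gen i) = e i.
Proof.
move=> L0.
have [x /lie_pi_eq0 xt|f fE] := @lie_hom_descend K _ _ _ fn_pi (fl_lift e)
  (@lie_pi_surj K _ _); first exact/L0/lower_central_hom.
by exists f => i; rewrite fE fl_lift_gen.
Qed.

Lemma fn_abelianization (f : lie_hom n_dt (abelian_lie K d)) :
    (forall i, f (fn_gen i) = abelian_gen K i) ->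
  lie_surj f /\ forall x, f x = 0 <-> x \in lower_central n_dt 2.
Proof.
move=> fE; split=> [y|x].
  exists (\sum_i (y : 'rV_d) 0 i *: fn_gen i).
  rewrite lie_hom_sum [RHS]row_sum_delta; apply: eq_bigr => i _.
  by rewrite lie_homZ fE.
split=> [fx|/(lower_central_hom f)/abelian_lower_central2//].
(* The quotient by [n^2] is abelian, so its projection [p] factors through [f]; hence [f x = 0]
   forces [p x = 0]. *)
pose p := lie_pi (lower_central n_dt 2).
have [|s sE] := @lie_hom_abelian K d {ideal_quot lower_central n_dt 2}
  (fun i => p (fn_gen i)).
  elim/quotW=> y; elim/quotW=> z; rewrite -lie_quot_piM.
  exact/lie_pi_eq0/lower_central_bracketS.
have {sE}sE : lie_comp s f =1 p by apply: fn_hom_eq => i; rewrite /= fE sE.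
by apply/lie_pi_eq0; rewrite -/p -sE /= fx lie_hom0.
Qed.

Lemma fn_abelianization_exists : (1 <= t)%N ->
  exists f : lie_hom n_dt (abelian_lie K d),
    forall i, f (fn_gen i) = abelian_gen K i.
Proof. by move=> t1; apply: fn_lift => x; apply: abelian_lower_central. Qed.

(** Projectivity of [n_{d,t}]: it suffices to lift the images of the generators, because
    homomorphisms that agree on generators are equal. *)
Lemma fn_hom_lift (L M : lieAlgType K) (p : lie_hom L M) (g : lie_hom n_dt M) :
    (forall x : L, x \in lower_central L t.+1 -> x = 0) -> lie_surj p ->
  exists f : lie_hom n_dt L, forall x, p (f x) = g x.
Proof.
move=> L0 ps; have [s sE] := dep_choice (fun i => ps (g (fn_gen i))).
have [f fE] := fn_lift s L0; exists f => x.
by apply: (@fn_hom_eq M (lie_comp p f) g) => i; rewrite /= fE sE.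
Qed.

End FreeNilpotent.

(** * Symmetric forms: construction, kernel and transport along homomorphisms *)

Section SymmetricForms.
Variable K : fieldType.
Implicit Types L M : lieAlgType K.

Section Build.
Variables (L : lieAlgType K) (f : L -> L -> K).
Hypothesis f_linear : forall z, linear_for *%R (f^~ z).
Hypothesis f_sym : forall x y, f x y = f y x.

(* The unused arguments carry the hypotheses, so that the bilinear and symmetric
   structures can be declared canonically on [build_form]. *)
Definition build_form & (forall z, linear_for *%R (f^~ z))
  & (forall x y, f x y = f y x) := f.
Local Notation F := (build_form f_linear f_sym).

Lemma build_form_zmodl z : zmod_morphism (F^~ z).
Proof. exact: zmod_morphism_linear (f_linear z). Qed.

Lemma build_form_zmodr z : zmod_morphism (F z).
Proof.
by move=> x y; rewrite /build_form !(f_sym z); apply: (build_form_zmodl z).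
Qed.

Lemma build_form_scalel z : scalable_for *%R (F^~ z).
Proof. exact: scalable_linear (f_linear z). Qed.

Lemma build_form_scaler z : scalable_for (idfun \; *%R) (F z).
Proof.
by move=> a x; rewrite /build_form !(f_sym z); apply: (build_form_scalel z).
Qed.

Lemma build_form_sym x y : F x y = (-1) ^+ false * idfun (F y x).
Proof. by rewrite mul1r; apply: f_sym. Qed.

HB.instance Definition _ := isBilinear.Build K L L K *%R (idfun \; *%R) F
  build_form_zmodl build_form_zmodr build_form_scalel build_form_scaler.
HB.instance Definition _ :=
  isHermitianSesquilinear.Build K L false idfun F build_form_sym.

Lemma symmetric_form_exists : exists B : {symmetric L}, forall x y, B x y = f x y.
Proof. by exists (F : {symmetric L}). Qed.

End Build.

Section Facts.
Variables (L : lieAlgType K) (B : {symmetric L}).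

Lemma sym_formC (x y : L) : B x y = B y x.
Proof. by rewrite [LHS]hermitian_subproof mul1r. Qed.

Lemma sym_form_linear z : linear_for *%R (B^~ z).
Proof.
move=> a x y; apply: etrans (linearDl B z (a *: x) y) _.
by congr (_ + _); apply: (linearZl_LR B).
Qed.

Lemma sym_formBl x y z : B (x - y) z = B x z - B y z.
Proof. exact: (linearBl B z x y). Qed.

Lemma form_kerP x : x \in form_ker B <-> forall y, B x y = 0.
Proof. by split=> [/asboolP|xB] //; apply/asboolP. Qed.

Lemma form_ker_zmod_closed : zmod_closed (form_ker B).
Proof.
split; first exact: form_ker0.
by move=> x y xB yB; apply/form_kerD/form_kerN.
Qed.

(* [form_ker B] is an ideal only for invariant [B]; the unused argument lets the
   ideal structure be declared canonically. *)
Definition invariant_ker & invariant_form B : {pred L} := form_ker B.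

Hypothesis B_inv : invariant_form B.

HB.instance Definition _ := GRing.isZmodClosed.Build L (invariant_ker B_inv)
  form_ker_zmod_closed.

Lemma invariant_ker_scale (a : K) (x : L) :
  x \in invariant_ker B_inv -> a *: x \in invariant_ker B_inv.
Proof.
move=> /form_kerP xB; apply/form_kerP => y.
have := sym_form_linear y a x 0; rewrite /= addr0 => ->.
by rewrite xB mulr0 (form_kerP 0).1 ?form_ker0 ?addr0.
Qed.

Lemma invariant_ker_bracket (x y : L) :
  x \in invariant_ker B_inv -> [lie x, y] \in invariant_ker B_inv.
Proof. by move=> /form_kerP xB; apply/form_kerP => z; rewrite B_inv xB. Qed.

HB.instance Definition _ := isLieIdeal.Build K L (invariant_ker B_inv)
  invariant_ker_scale invariant_ker_bracket.

Lemma invariant_quotient :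
  exists (M : lieAlgType K) (p : lie_hom L M),
    lie_surj p /\ forall x, p x = 0 <-> x \in form_ker B.
Proof.
exists {ideal_quot (invariant_ker B_inv)}, (lie_pi (invariant_ker B_inv)).
by split=> [|x]; [apply: lie_pi_surj | apply: lie_pi_eq0].
Qed.

End Facts.

(** The new form is [B] evaluated on a section of [p]. The kernel condition makes this independent
    of the section in the first argument, and symmetry carries that over to the second. *)
Lemma form_descend L M (p : lie_hom L M) (B : {symmetric L}) :
    lie_surj p -> (forall x, p x = 0 -> x \in form_ker B) ->
  exists B' : {symmetric M}, forall x y, B x y = B' (p x) (p y).
Proof.
move=> /dep_choice[s sK] pB.
have Bs x y z : p x = p y -> B x z = B y z.
  move=> pxy; apply/eqP; rewrite -subr_eq0 -sym_formBl; apply/eqP.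
  by apply/form_kerP: z; apply: pB; rewrite lie_homB pxy subrr.
have [a x y z|x y|B' B'E] := @symmetric_form_exists M (fun x y => B (s x) (s y)).
- rewrite -sym_form_linear; apply: Bs.
  by rewrite lie_homD lie_homZ !sK.
- exact: sym_formC.
exists B' => x y; rewrite B'E (Bs _ x) ?sK // sym_formC.
by rewrite [RHS]sym_formC; apply: Bs; rewrite sK.
Qed.

Lemma form_pullback L M (p : lie_hom L M) (B' : {symmetric M}) :
  exists B : {symmetric L}, forall x y, B x y = B' (p x) (p y).
Proof.
apply: symmetric_form_exists => [z a x y|x y]; last exact: sym_formC.
by rewrite lie_homD lie_homZ sym_form_linear.
Qed.

End SymmetricForms.

(** * Presentations of quadratic algebras and their morphisms *)

Section Presentations.
Variables (K : fieldType) (d t : nat).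
Hypothesis t_ge1 : (1 <= t)%N.
Local Notation n_dt := (free_nilpotent K d t).
Implicit Types (B : sym0 K d t) (N : nilp_quad K d t).

Definition presents B N (p : lie_hom n_dt N) :=
  lie_surj p /\ forall x y, B x y = nq_form N (p x) (p y).

Lemma presents_ker B N (p : lie_hom n_dt N) x :
  presents B p -> p x = 0 <-> x \in form_ker B.
Proof.
case=> ps pB; split=> [px|/form_kerP xB].
  by apply/form_kerP => y; rewrite pB px; apply: (form_kerP _ 0).1; apply: form_ker0.
apply: nq_nondegenerate; apply/form_kerP => z.
by have [y <-] := ps z; rewrite -pB.
Qed.

Lemma sym0_presentation B : exists N (p : lie_hom n_dt N), presents B p.
Proof.
have [M [p [ps p0]]] := invariant_quotient (@s0_invariant _ _ _ B).
have [|B' BE] := form_descend ps (B := B); first by move=> x /p0.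
have B'inv : invariant_form B'.
  move=> x y z; have [x' <-] := ps x; have [y' <-] := ps y.
  by have [z' <-] := ps z; rewrite -!lie_homM -!BE s0_invariant.
have B'nd : nondegenerate_form B'.
  move=> x; have [y <-] := ps x => /form_kerP yB; apply/p0/form_kerP => z.
  by rewrite BE yB.
have Mnil : nilpotent_class M t.
  split=> [x /(lower_central_surj ps)[y /fn_lower_central-> <-]|].
    exact: lie_hom0.
  (* If [M^t] were zero, [p] would kill [n^t], which would then lie in [Ker B]. *)
  apply: contrapT => Mt; apply: (@s0_ker_top _ _ _ B) => x xt.
  apply/p0; apply: contrapT => /eqP px; apply: Mt; exists (p x).
  by split=> //; apply: lower_central_hom.
(* Since [Ker B] lies in [n^2], the abelianization [f] of [n_{d,t}] factors through [p], and the
   kernel of the resulting [q] is [M^2]. *)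
have Mtype : has_type M d.
  have [f fE] := fn_abelianization_exists K d t_ge1.
  have [fs f0] := fn_abelianization fE; apply/has_typeP.
  have [|q qE] := lie_hom_descend (g := f) ps.
    by move=> x /p0/s0_ker_sub/f0.
  exists q; split=> [y|y]; first by have [x <-] := fs y; exists (p x).
  split=> [|/(lower_central_hom q)/abelian_lower_central2//].
  have [x <-] := ps y; rewrite qE => /f0; exact: lower_central_hom.
by exists (NilpQuadObj B'inv B'nd Mnil Mtype), p; split.
Qed.

Lemma nilp_quad_presentation N : exists B (p : lie_hom n_dt N), presents B p.
Proof.
have [N0 [top [topN top0]]] := nq_nilpotent N.
have /has_typeP[q [qs q0]] := nq_type N.
have [e eE] := dep_choice (fun i => qs (abelian_gen K i)).
have [p pE] := fn_lift e N0.
have qpE i : lie_comp q p (fn_gen K t i) = abelian_gen K i by rewrite /= pE eE.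
have [qps qp0] := fn_abelianization qpE.
(* The composite of [q] and [p] is the abelianization of [n_{d,t}], hence onto; so [p] reaches every
   element modulo [N^2]. *)
have ps : lie_surj p.
  apply: (nilpotent_surj N0) => y; have [x qx] := qps (q y).
  by exists x; apply/q0; rewrite lie_homB -qx /= subrr.
have [B BE] := form_pullback p (nq_form N).
have Binv : invariant_form B.
  by move=> x y z; rewrite !BE !lie_homM nq_invariant.
have kerB x : x \in form_ker B -> p x = 0.
  move=> /form_kerP xB; apply: nq_nondegenerate; apply/form_kerP => z.
  by have [y <-] := ps z; rewrite -BE.
have Bsub : {subset form_ker B <= lower_central n_dt 2}.
  by move=> x /kerB px; apply/qp0; rewrite /= px lie_hom0.
have Btop : ~ {subset lower_central n_dt t <= form_ker B}.
  have [x xt xE] := lower_central_surj ps topN => /(_ x xt)/kerB.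
  by rewrite xE; apply/eqP.
by exists (Sym0Obj Binv Bsub Btop), p; split.
Qed.

Section Morphisms.
Variables (B1 B2 : sym0 K d t) (N1 N2 : nilp_quad K d t).
Variables (p1 : lie_hom n_dt N1) (p2 : lie_hom n_dt N2).
Hypotheses (p1B : presents B1 p1) (p2B : presents B2 p2).

Lemma metric_end_descend (f : metric_end B1 B2) :
  exists h : nilp_quad_hom N1 N2, forall x, h (p1 x) = p2 (f x).
Proof.
have [|h hE] := lie_hom_descend (g := lie_comp p2 f) p1B.1.
  by move=> x /(presents_ker x p1B)/(me_ker f)/(presents_ker _ p2B).
have hB x y : nq_form N1 x y = nq_form N2 (h x) (h y).
  have [x' <-] := p1B.1 x; have [y' <-] := p1B.1 y.
  by rewrite !hE -p1B.2 (me_isometry f) p2B.2.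
by exists (NilpQuadHom hB).
Qed.

(** Once [h] is lifted as a Lie homomorphism, both metric conditions follow, because the forms and
    their kernels are read off through [p1] and [p2]. *)
Lemma metric_end_lift (h : nilp_quad_hom N1 N2) :
  exists f : metric_end B1 B2, forall x, h (p1 x) = p2 (f x).
Proof.
have [f fE] := fn_hom_lift (lie_comp h p1) (@fn_lower_central K d t) p2B.1.
have fB x y : B1 x y = B2 (f x) (f y).
  by rewrite p1B.2 (nq_hom_isometry h) p2B.2 !fE.
have fker x : x \in form_ker B1 -> f x \in form_ker B2.
  move=> /(presents_ker x p1B) px; apply/(presents_ker _ p2B).
  by rewrite fE /= px lie_hom0.
by exists (MetricEnd fB fker) => x; rewrite /= fE.
Qed.

Lemma sym0_hom_presentsP (f g : metric_end B1 B2) :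
  \pi_(sym0_hom B1 B2) f = \pi_(sym0_hom B1 B2) g <->
  forall x, p2 (f x) = p2 (g x).
Proof.
rewrite sym0_homP; split=> fg x; have := fg x.
  by move/(presents_ker _ p2B)/eqP; rewrite lie_homB subr_eq0 => /eqP.
by move=> fgx; apply/(presents_ker _ p2B); rewrite lie_homB fgx subrr.
Qed.

End Morphisms.
End Presentations.

Theorem theorem4p2 (K : fieldType) (charK0 : [pchar K] =i pred0)
    (d t : nat) (d_ge1 : (1 <= d)%N) (t_ge1 : (1 <= t)%N) :
  equivalent_categories (Sym0 K d t) (NilpQuad K d t).
Proof.
have [Q /dep_choice[p pP]] := dep_choice (@sym0_presentation K d t t_ge1).
have ind B1 B2 (f : sym0_hom B1 B2) :=
  cid (metric_end_descend (pP B1) (pP B2) (repr f)).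
pose F1 B1 B2 f := sval (ind B1 B2 f).
(* [F1] is defined from the canonical representative of a class; this equation shows that any other
   representative induces the same map. *)
have F1E B1 B2 (f : metric_end B1 B2) x :
    F1 B1 B2 (\pi_(sym0_hom B1 B2) f) (p B1 x) = p B2 (f x).
  rewrite (svalP (ind _ _ _)).
  by apply/(sym0_hom_presentsP (pP B2)): x; rewrite reprK.
have F1id B : F1 B B (sym0_id B) = nilp_quad_id (Q B).
  by apply: nilp_quad_hom_eq => y; have [x <-] := (pP B).1 y; rewrite F1E.
have F1comp B1 B2 B3 (g : sym0_hom B2 B3) (f : sym0_hom B1 B2) :
    F1 B1 B3 (sym0_comp g f) = nilp_quad_comp (F1 B2 B3 g) (F1 B1 B2 f).
  apply: nilp_quad_hom_eq => y; have [x <-] := (pP B1).1 y.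
  elim/quotW: f => f; elim/quotW: g => g.
  by rewrite sym0_compE F1E /= !F1E.
pose F : cfunctor (Sym0 K d t) (NilpQuad K d t) :=
  @Functor (Sym0 K d t) (NilpQuad K d t) Q F1 F1id F1comp.
apply: (@fully_faithful_equivalence _ _ F) => [B1 B2 h|B1 B2|N].
- have [f fE] := metric_end_lift (pP B1) (pP B2) h.
  exists (\pi_(sym0_hom B1 B2) f); apply: nilp_quad_hom_eq => y.
  by have [x <-] := (pP B1).1 y; rewrite /= F1E fE.
- elim/quotW=> f; elim/quotW=> g fg; apply/(sym0_hom_presentsP (pP B2)) => x.
  by rewrite -!F1E; congr (nq_hom _ _); apply: fg.
(* [N] and [Q B] are both presented by [B], so the identity of [n_{d,t}] descends in both directions
   to mutually inverse isometries. *)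
have [B [q qP]] := nilp_quad_presentation N.
have [e eE] := metric_end_descend (pP B) qP (me_id B).
have [e' e'E] := metric_end_descend qP (pP B) (me_id B).
exists B, e, e'; split; apply: nilp_quad_hom_eq => y.
  by have [x <-] := (pP B).1 y; rewrite /= eE e'E.
by have [x <-] := qP.1 y; rewrite /= e'E eE.
Qed.
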